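(* The map $\xi_{\mathcal{MG}}:\operatorname{Spec}(R)\to\mathbb{B}_{\mathcal{O}}$ induced by the $\mathcal{O}$-border basis $\mathcal{MG}=\{b_j+Y(b_j)+\tau(b_j)\mid b_j\in\partial\mathcal{O}\}\subseteq R[\mathbf{x}]$, $R=K[\mathcal{C},\Theta]$, is a closed immersion; equivalently, the comorphism $\xi^*_{\mathcal{MG}}:A_{\mathcal{O}}\to R$ is surjective.
   Context: $K$ is an algebraically closed field of characteristic $0$, $K[\mathbf{x}]=K[x_1,\dots,x_n]$, $\mathbb{T}^n$ is the set of monomials in $x_1,\dots,x_n$, $\mathbb{T}^n_d$ those of degree $d$. Monomial inequalities refer to lexicographic order with $x_1>\dots>x_n$ (on monomials of arbitrary degrees). Negative degree-lexicographic listing of monomials: $m$ comes before $m'$ iff $\deg m<\deg m'$, or $\deg m=\deg m'$ and $m>m'$. Admissible order ideal: fix integers $2\le r<s$ and monomials $\mathcal{W}_d\in\mathbb{T}^n_d$ for $r\le d\le s+1$ such that $\mathcal{W}_{s+1}=x_n^{s+1}$; $x_n\mathcal{W}_d\ge\mathcal{W}_{d+1}$ for $r\le d<s$; $\mathcal{W}_s>x_n^s$. Put $\mathcal{O}=\bigcup_{d=0}^{s+1}\mathcal{O}_d$, where $\mathcal{O}_d=\mathbb{T}^n_d$ for $d\le r-1$ and $\mathcal{O}_d=\{m\in\mathbb{T}^n_d\mid \mathcal{W}_d>m\}$ for $r\le d\le s+1$. Border: $\partial\mathcal{O}=(\bigcup_k x_k\mathcal{O})\setminus\mathcal{O}$.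 List $\mathcal{O}=\{t_1,\dots,t_\mu\}$ and $\partial\mathcal{O}=\{b_1,\dots,b_\nu\}$ in negative degree-lexicographic order. $\mathcal{N}=\{m\in\mathbb{T}^n\mid r\le\deg m\le s+1,\ m\notin\mathcal{O}\}\supseteq\partial\mathcal{O}$, $\mathcal{N}_{\le s}=\{m\in\mathcal{N}\mid\deg m\le s\}$; $\operatorname{LM}=\{b\in\partial\mathcal{O}\mid\deg b\le s,\ x_k\mid b\Rightarrow b/x_k\in\mathcal{O}\ \forall k\}$; $\operatorname{TM}=\mathcal{O}_s$. $\mathcal{C}=\{C_{i,j}\mid t_i\in\operatorname{TM},\ b_j\in\operatorname{LM}\}$ are indeterminates. For $m\in\mathcal{N}$ put $Y(m)=-\sum_{t_i\in\operatorname{TM}}C_{i,j}t_i$ if $m=b_j\in\operatorname{LM}$ and $Y(m)=0$ otherwise. $\operatorname{lv}(m)$ is the largest variable dividing $m$ and $\operatorname{ld}(m)$ its exponent in $m$. $x_k$ is a key variable if $x_k=\operatorname{lv}(m)$ for some $m\in\mathcal{N}_{\le s}$; then the key monomial $\chi_k$ is the lex-minimal element of $\{m'\in\operatorname{LM}\mid\operatorname{lv}(m')=x_k\}$, written $\chi_k=x_k^{e_k}\hat m_k$ with $e_k=\operatorname{ld}(\chi_k)$. Target seed monomials: $\mathcal{T}_k=\{t/\hat m_k\mid t\in\mathcal{O},\ \deg t\ge\deg\chi_k,\ \hat m_k\mid t,\text{ and }\chi_k\in\operatorname{LM}\Rightarrow t\notin\operatorname{TM}\}=\{t_{k,1},\dots,t_{k,\rho_k}\}$.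 $\Theta=\{\theta_{k,q}\mid x_k\text{ key},1\le q\le\rho_k\}$ are further indeterminates, $\sigma_k=\sum_q\theta_{k,q}t_{k,q}$, and $R=K[\mathcal{C},\Theta]$. Initial target of $m\in\mathcal{N}$: if $\deg m\le s$ and $\operatorname{lv}(m)=x_k$, then $\tau'(m)$ is $(m/x_k^{e_k})\cdot\sigma_k$ with all terms of degree $\ge s+1$ deleted (here $\operatorname{ld}(m)\ge e_k$); if $\deg m=s+1$, $\tau'(m)=0$. Targets $\tau(m)\in\operatorname{Span}_R(\mathcal{O})$, $m\in\mathcal{N}$, are defined recursively, from the last to the first element of $\mathcal{N}$ in negative degree-lexicographic order: $\tau(m)$ is obtained from $\tau'(m)$ by replacing each monomial $m'\notin\mathcal{O}$ occurring in it by $-(Y(m')+\tau(m'))$ (each such $m'$ lies in $\mathcal{N}$ and comes after $m$). $\mathcal{MG}$ is an $\mathcal{O}$-border basis: $R[\mathbf{x}]/(\mathcal{MG})$ is $R$-free with basis $\mathcal{O}$. Border basis scheme: let $c_{i,j}$ ($1\le i\le\mu$, $1\le j\le\nu$) be indeterminates and $f_j=b_j-\sum_i c_{i,j}t_i\in K[c_{i,j}][\mathbf{x}]$. For each pair $b_j,b_{j'}$ with $x_kb_j=x_\ell b_{j'}$ ($k,\ell\in\{0,\dots,n\}$, $x_0=1$, not both equal to $x_0$), the S-polynomial $x_kf_j-x_\ell f_{j'}$ is reduced to an element of $\operatorname{Span}_{K[c_{i,j}]}(\mathcal{O})$ by replacing every boundary monomial $b_q$ in it by $\sum_i c_{i,q}t_i$.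 $\mathcal{I}_{\mathcal{O}}$ is the ideal generated by all coefficients of these reductions, $A_{\mathcal{O}}=K[c_{i,j}]/\mathcal{I}_{\mathcal{O}}$, $\mathbb{B}_{\mathcal{O}}=\operatorname{Spec}(A_{\mathcal{O}})$. For a $K$-algebra $R$ and an $\mathcal{O}$-border basis $\{b_j-\sum_i z_{i,j}t_i\}\subseteq R[\mathbf{x}]$, the induced map $\operatorname{Spec}(R)\to\mathbb{B}_{\mathcal{O}}$ has comorphism $A_{\mathcal{O}}\to R$, $c_{i,j}\mapsto z_{i,j}$. *)

(* Defs.v *)
From HB Require Import structures.
From mathcomp Require Import all_boot all_order all_algebra.
From mathcomp Require Import boolp.
From mathcomp Require Import mpoly.

Set Implicit Arguments.
Unset Strict Implicit.
Unset Printing Implicit Defensive.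

Import GRing.Theory.
Local Open Scope ring_scope.
Local Open Scope quotient_scope.

(* [{mpoly K[T]^fin}] is the polynomial ring over [K] whose indeterminates are
   the elements of the finite type [T]; [mvar K t] is the indeterminate of
   index [t]. *)
Notation "{ 'mpoly' K [ T ]^fin }" := {mpoly K[#|{: T}|]}
  (at level 0, K, T at level 2, format "{ 'mpoly'  K [ T ]^fin }") : type_scope.

Definition mvar (K : nzRingType) (T : finType) (t : T) : {mpoly K[T]^fin} :=
  'X_(enum_rank t).

Definition ideal_gen (A : comNzRingType) (S : A -> Prop) (f : A) : Prop :=
  exists l : seq (A * A),
    (forall p, p \in l -> S p.2) /\ f = \sum_(p <- l) p.1 * p.2.

Lemma ideal_genD (A : comNzRingType) (S : A -> Prop) a u v :
  ideal_gen S u -> ideal_gen S v -> ideal_gen S (a * u + v).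
Proof.
move=> [lu [Hu ->]] [lv [Hv ->]].
exists ([seq (a * p.1, p.2) | p <- lu] ++ lv); split.
  by move=> p; rewrite mem_cat => /orP[/mapP[q ql ->] /=|]; [exact: Hu|exact: Hv].
rewrite big_cat big_map mulr_sumr /=; congr (_ + _).
by apply: eq_bigr => p _; rewrite mulrA.
Qed.

Section BorderBasis.

Variables (n : nat) (O : seq 'X_{1..n}).

Definition border : seq 'X_{1..n} :=
  undup [seq m <- [seq (U_(k) + t)%MM | k <- enum 'I_n, t <- O] | m \notin O].

Local Notation Oidx := (seq_sub O).
Local Notation Bidx := (seq_sub border).

Definition is_border_basis (R : comNzRingType) (G : Bidx -> {mpoly R[n]}) :=
  (forall b, {subset msupp (G b - 'X_[val b]) <= O}) /\
  (forall f : {mpoly R[n]}, exists! a : {ffun Oidx -> R},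
     ideal_gen (fun g => exists b, g = G b)
       (f - \sum_(t : Oidx) a t *: 'X_[val t])).

Variable K : fieldType.

Local Notation CR := {mpoly K[Oidx * Bidx]^fin}.

(* The indeterminate c_(i,j), indexed by t_i and b_j instead of i and j. *)
Definition cvar (t : Oidx) (b : Bidx) : CR := mvar K (t, b).

Definition generic_poly (b : Bidx) : {mpoly CR[n]} :=
  'X_[val b] - \sum_(t : Oidx) cvar t b *: 'X_[val t].

Definition border_reduce (p : {mpoly CR[n]}) : {mpoly CR[n]} :=
  \sum_(m <- msupp p) p@_m *:
    (if insub m is Some b then \sum_(t : Oidx) cvar t b *: 'X_[val t]
     else 'X_[m]).

(* [None] stands for the index 0, with x_0 = 1. *)
Definition mvar0 (k : option 'I_n) : 'X_{1..n} :=
  if k is Some i then U_(i)%MM else 0%MM.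

Definition spoly (k l : option 'I_n) (b b' : Bidx) : {mpoly CR[n]} :=
  'X_[mvar0 k] * generic_poly b - 'X_[mvar0 l] * generic_poly b'.

Definition scheme_gen (p : CR) : Prop :=
  exists (k l : option 'I_n) (b b' : Bidx) (t : Oidx),
    [/\ (k, l) <> (None, None),
        (mvar0 k + val b)%MM = (mvar0 l + val b')%MM &
        p = (border_reduce (spoly k l b b'))@_(val t)].

(* [{ideal_quot _}] expects a boolean predicate. *)
Definition scheme_ideal : {pred CR} := fun p => `[< ideal_gen scheme_gen p >].

(* Properness, required by [{ideal_quot _}]: the origin is a point of the
   border basis scheme. *)
Lemma scheme_gen_origin p : scheme_gen p -> p.@[fun=> 0] = 0.
Proof.
have ev_c t b : (cvar t b).@[fun=> 0] = 0 by rewrite mevalXU.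
have ev_g k b m : (('X_[mvar0 k] * generic_poly b)@_m).@[fun=> 0]
                  = ((mvar0 k + val b)%MM == m)%:R :> K.
  rewrite mulrBr mcoeffB mevalB -mpolyXD mcoeffX rmorph_nat.
  suff -> : (('X_[mvar0 k] * (\sum_t cvar t b *: 'X_[val t]))@_m).@[fun=> 0] = 0.
    by rewrite subr0.
  rewrite mulr_sumr raddf_sum raddf_sum big1 // => u _ /=.
  by rewrite -scalerAr mcoeffZ mevalM ev_c mul0r.
case=> k [l [b [b' [t [_ e ->]]]]].
rewrite /border_reduce raddf_sum raddf_sum big1 //= => m _.
by rewrite mcoeffZ mevalM /spoly mcoeffB mevalB !ev_g e subrr mul0r.
Qed.

Lemma scheme_ideal_closed : idealr_closed scheme_ideal.
Proof.
split.
- by apply/asboolP; exists [::]; rewrite big_nil.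
- apply/negP => /asboolP [l [Hl /(congr1 (meval (fun=> 0)))]].
  rewrite meval1 raddf_sum big_seq big1 => [/eqP|p pl].
    by rewrite oner_eq0.
  by rewrite /= mevalM (scheme_gen_origin (Hl p pl)) mulr0.
- by move=> a u v /asboolP Hu /asboolP Hv; apply/asboolP/ideal_genD.
Qed.

HB.instance Definition _ := isIdealr.Build CR scheme_ideal scheme_ideal_closed.

Definition scheme_ring : Type := {ideal_quot scheme_ideal}.

HB.instance Definition _ := GRing.ComNzRing.on scheme_ring.

Definition scheme_proj : CR -> scheme_ring := \pi_{ideal_quot scheme_ideal}.

Lemma scheme_projD : {morph scheme_proj : p q / p + q}.
Proof. exact: raddfD. Qed.

Lemma scheme_projM : {morph scheme_proj : p q / p * q}.
Proof. exact: rmorphM. Qed.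

Lemma scheme_proj1 : scheme_proj 1 = 1.
Proof. exact: rmorph1. Qed.

Definition scheme_scale (a : K) (x : scheme_ring) : scheme_ring :=
  scheme_proj a%:MP * x.

Fact scheme_scaleA a b x :
  scheme_scale a (scheme_scale b x) = scheme_scale (a * b) x.
Proof. by rewrite /scheme_scale mpolyCM scheme_projM mulrA. Qed.

Fact scheme_scale1 : left_id 1 scheme_scale.
Proof. by move=> x; rewrite /scheme_scale scheme_proj1 mul1r. Qed.

Fact scheme_scaleDr : right_distributive scheme_scale +%R.
Proof. by move=> a x y; rewrite /scheme_scale mulrDr. Qed.

Fact scheme_scaleDl x : {morph scheme_scale^~ x : a b / a + b}.
Proof. by move=> a b; rewrite /scheme_scale mpolyCD scheme_projD mulrDl. Qed.

HB.instance Definition _ := GRing.Zmodule_isLmodule.Build K scheme_ring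
  scheme_scaleA scheme_scale1 scheme_scaleDr scheme_scaleDl.

Fact scheme_scaleAl (a : K) (x y : scheme_ring) : a *: (x * y) = a *: x * y.
Proof. exact: mulrA. Qed.

HB.instance Definition _ :=
  GRing.Lmodule_isLalgebra.Build K scheme_ring scheme_scaleAl.

(* For a border basis [G], z_(i,j) is minus the coefficient of t_i in the
   member of [G] with border monomial b_j. *)
Definition induced_comorphism (R : comAlgType K) (G : Bidx -> {mpoly R[n]})
    (xi : {lrmorphism scheme_ring -> R}) : Prop :=
  forall t b, xi (scheme_proj (cvar t b)) = - (G b)@_(val t).

End BorderBasis.

Section Monomials.

Variable n : nat.
Implicit Types m : 'X_{1..n}.

(* Lexicographic order; the variable of index 0 is the largest one. *)
Definition lex_lt m m' : bool :=
  [exists i : 'I_n, (m i < m' i)%N &&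
     [forall j : 'I_n, (j < i)%N ==> (m j == m' j)]].

Definition lex_le m m' : bool := (m == m') || lex_lt m m'.

(* [m] is listed before (or equals) [m'] in negative degree-lexicographic
   order. *)
Definition ndeglex_le m m' : bool :=
  (mdeg m < mdeg m')%N || ((mdeg m == mdeg m') && lex_le m' m).

Definition monomials_le (d : nat) : seq 'X_{1..n} :=
  [seq bmnm u | u <- enum {: 'X_{1..n < d.+1}}].

(* [None] only for the monomial 1. *)
Definition lv m : option 'I_n :=
  [pick i : 'I_n | (0 < m i)%N & [forall j : 'I_n, (j < i)%N ==> (m j == 0%N)]].

End Monomials.

(* There are [n.+1] variables, so that the last one exists: it is the one of
   index [ord_max]. *)
Definition admissible (n r s : nat) (W : nat -> 'X_{1..n.+1}) : Prop :=
  [/\ (2 <= r)%N /\ (r < s)%N,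
      (forall d, (r <= d <= s.+1)%N -> mdeg (W d) = d),
      W s.+1 = (U_(ord_max) *+ s.+1)%MM,
      (forall d, (r <= d < s)%N -> lex_le (W d.+1) (U_(ord_max) + W d)%MM) &
      lex_lt (U_(ord_max) *+ s)%MM (W s)].

Section Construction.

Variables (n r s : nat) (W : nat -> 'X_{1..n.+1}).

Local Notation monomial := 'X_{1..n.+1}.

Definition in_order_ideal (m : monomial) : bool :=
  (mdeg m < r)%N || ((mdeg m <= s.+1)%N && lex_lt m (W (mdeg m))).

Definition order_ideal : seq monomial :=
  [seq m <- monomials_le n.+1 s.+1 | in_order_ideal m].

Local Notation O := order_ideal.

Definition Nset : seq monomial :=
  [seq m <- monomials_le n.+1 s.+1 | (r <= mdeg m)%N && (m \notin O)].

Definition LM : seq monomial :=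
  [seq b <- border O | (mdeg b <= s)%N &&
     [forall k : 'I_n.+1, (0 < b k)%N ==> ((b - U_(k))%MM \in O)]].

Definition TM : seq monomial := [seq t <- O | mdeg t == s].

Definition is_key (k : 'I_n.+1) : bool :=
  has (fun m => (mdeg m <= s)%N && (lv m == Some k)) Nset.

(* The default value 0 is irrelevant when x_k is a key variable. *)
Definition key_mono (k : 'I_n.+1) : monomial :=
  head 0%MM (sort (@lex_le n.+1) [seq m <- LM | lv m == Some k]).

Definition key_exp (k : 'I_n.+1) : nat := key_mono k k.

Definition key_cofactor (k : 'I_n.+1) : monomial :=
  (key_mono k - U_(k) *+ key_exp k)%MM.

(* Empty when x_k is not a key variable, so that only key variables
   contribute indeterminates. *)
Definition target_seeds (k : 'I_n.+1) : seq monomial :=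
  if is_key k then
    [seq (t - key_cofactor k)%MM | t <- O &
       [&& (mdeg (key_mono k) <= mdeg t)%N, (key_cofactor k <= t)%MM &
           (key_mono k \in LM) ==> (t \notin TM)]]
  else [::].

(* The indeterminates C_(i,j), indexed by t_i and b_j, and theta_(k,q),
   indexed by k and t_(k,q). *)
Definition param : finType :=
  ((seq_sub TM * seq_sub LM) + {k : 'I_n.+1 & seq_sub (target_seeds k)})%type.

Variable K : fieldType.

Local Notation R := {mpoly K[param]^fin}.
Local Notation poly := {mpoly R[n.+1]}.

Definition Cvar (t : seq_sub TM) (b : seq_sub LM) : R :=
  mvar K (inl (t, b) : param).

Definition theta (k : 'I_n.+1) (q : seq_sub (target_seeds k)) : R :=
  mvar K (inr (Tagged (fun i => seq_sub (target_seeds i)) q) : param).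

Definition Ypoly (m : monomial) : poly :=
  if insub m is Some b then - \sum_(t : seq_sub TM) Cvar t b *: 'X_[val t]
  else 0.

Definition sigma (k : 'I_n.+1) : poly :=
  \sum_(q : seq_sub (target_seeds k)) theta q *: 'X_[val q].

Definition initial_target (m : monomial) : poly :=
  if (mdeg m <= s)%N then
    if lv m is Some k then
      let p := 'X_[(m - U_(k) *+ key_exp k)%MM] * sigma k in
      \sum_(t <- msupp p | (mdeg t <= s)%N) p@_t *: 'X_[t]
    else 0
  else 0.

Definition subst_targets (tau : monomial -> poly) (p : poly) : poly :=
  \sum_(t <- msupp p) p@_t *:
    (if t \in O then 'X_[t] else - (Ypoly t + tau t)).

(* [l] lists monomials in order; their targets are computed from the last one
   to the first one. *)
Fixpoint targets (l : seq monomial) : monomial -> poly :=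
  if l is m :: l' then
    let tau := targets l' in
    fun m' => if m' == m then subst_targets tau (initial_target m) else tau m'
  else fun=> 0.

Definition target : monomial -> poly :=
  targets (sort (@ndeglex_le n.+1) Nset).

Definition MG (b : seq_sub (border O)) : poly :=
  'X_[val b] + Ypoly (val b) + target (val b).

End Construction.

(* Main.v *)
(* Let [phi] be the R-linear map that fixes the monomials of O and sends a
   monomial m outside O to -(Y(m) + tau(m)), so that b + Y(b) + tau(b) is
   b - phi(b).  It suffices to show that the kernel of [phi] is an ideal.  This
   kernel contains all monomials of degree > s and all the polynomials
   Y(m) + (m / x_k^(e_k)) * (x_k^(e_k) + sigma_k), where lv(m) = x_k; together
   they span it.  Since x_i Y(m) has degree s + 1, one must show that
   v * (m / x_k^(e_k)) * (x_k^(e_k) + sigma_k) is in the kernel for every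
   monomial v <> 1.  If lv(v) <= x_k, this is the polynomial attached to v m,
   as Y(v m) = 0.  Otherwise lv(v) = x_j > x_k, which forces e_j = 1; writing
   v = x_j v', the product v' * (m / x_k^(e_k)) * (x_k^(e_k) + sigma_k)
   * (x_j + sigma_j) is a combination of polynomials attached to x_j, while
   v' sigma_j only involves monomials that come after v, so that an induction
   on v, from the last monomial to the first one, concludes.

   The comorphism is surjective because theta_(k,q) is the coefficient of
   m_k t_(k,q) in the member of MG attached to chi_k, and C_(i,j) is, up to
   sign, the sum of the coefficient of t_i in the member attached to b_j and a
   polynomial in the theta's and in coefficients attached to monomials that
   come after b_j. *)
Require Import Defs.
From HB Require Import structures.
From mathcomp Require Import all_boot all_order all_algebra.
From mathcomp Require Import boolp ssrcomplements mpoly zify.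

Set Implicit Arguments.
Unset Strict Implicit.
Unset Printing Implicit Defensive.

Import GRing.Theory.
Local Open Scope ring_scope.

(** * Lexicographic orders on monomials *)

Section Lex.

Variable n : nat.
Implicit Types m p u : 'X_{1..n}.

Lemma lex_ltP m m' :
  reflect (exists2 i : 'I_n, (m i < m' i)%N
                           & forall j : 'I_n, (j < i)%N -> m j = m' j)
          (lex_lt m m').
Proof.
apply: (iffP existsP) => [[i /andP[lti /forallP eqi]]|[i lti eqi]]; exists i => //.
  by move=> j ltji; apply/eqP; move: (eqi j); rewrite ltji.
by rewrite lti; apply/forallP => j; apply/implyP => /eqi ->.
Qed.

Lemma lex_ltxx m : lex_lt m m = false.
Proof. by apply/lex_ltP => -[i]; rewrite ltnn. Qed.

Lemma lex_lt_trans : transitive (@lex_lt n).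
Proof.
move=> m2 m1 m3 /lex_ltP[i lti eqi] /lex_ltP[j ltj eqj]; apply/lex_ltP.
case: (ltngtP i j) => [ltij|ltji|/val_inj eqij].
- exists i => [|l ltl]; first by rewrite -eqj.
  by rewrite eqi // eqj // (ltn_trans ltl).
- exists j => [|l ltl]; first by rewrite eqi.
  by rewrite eqi ?eqj // (ltn_trans ltl).
- rewrite -{j}eqij in ltj eqj.
  by exists i => [|l ltl]; [exact: ltn_trans ltj|rewrite eqi // eqj].
Qed.

(** The smallest index at which the exponents differ decides the comparison. *)
Lemma lex_lt_total m m' : m != m' -> lex_lt m m' || lex_lt m' m.
Proof.
move=> nem.
have [i ni] : exists i, m i != m' i.
  apply/existsP; apply: contraNT nem => /existsPn eqm.
  by apply/eqP/mnmP => i; apply/eqP; rewrite -[_ == _]negbK eqm.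
case: (arg_minnP (P := fun i => m i != m' i) (@nat_of_ord n) ni) => {ni}i ni mini.
have eqi (j : 'I_n) : (j < i)%N -> m j = m' j.
  by move=> ltji; apply/eqP; apply: contraLR ltji => /mini; rewrite -leqNgt.
by case: (ltngtP (m i) (m' i)) ni => // lti _; apply/orP; [left|right];
   apply/lex_ltP; exists i => // j /eqi.
Qed.

Lemma lex_lexx m : lex_le m m.
Proof. by rewrite /lex_le eqxx. Qed.

Lemma lex_le_lt_trans m2 m1 m3 : lex_le m1 m2 -> lex_lt m2 m3 -> lex_lt m1 m3.
Proof. by case/orP => [/eqP-> //|]; exact: lex_lt_trans. Qed.

Lemma lex_lt_le_trans m2 m1 m3 : lex_lt m1 m2 -> lex_le m2 m3 -> lex_lt m1 m3.
Proof. by move=> lt12 /orP[/eqP<- //|]; exact: lex_lt_trans. Qed.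

Lemma lex_le_trans : transitive (@lex_le n).
Proof.
move=> m2 m1 m3 /orP[/eqP-> //|lt12] le23.
by rewrite /lex_le (lex_lt_le_trans lt12 le23) orbT.
Qed.

Lemma lex_le_total : total (@lex_le n).
Proof.
move=> m m'; rewrite /lex_le; case: (eqVneq m m') => //= /lex_lt_total.
by case/orP=> ->; rewrite ?orbT.
Qed.

Lemma lex_ltNge m m' : lex_lt m m' = ~~ lex_le m' m.
Proof.
rewrite /lex_le eq_sym; case: (eqVneq m m') => [->|/lex_lt_total]; rewrite ?lex_ltxx //=.
case: (boolP (lex_lt m' m)) => //= ltm'm; case: (boolP (lex_lt m m')) => // ltmm' _.
by have := lex_lt_trans ltmm' ltm'm; rewrite lex_ltxx.
Qed.

Lemma lex_lt_add2l p m m' : lex_lt (p + m)%MM (p + m')%MM = lex_lt m m'.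
Proof.
apply/lex_ltP/lex_ltP => -[i lti eqi]; exists i.
- by rewrite !mnmDE ltn_add2l in lti.
- by move=> j /eqi; rewrite !mnmDE => /addnI.
- by rewrite !mnmDE ltn_add2l.
- by move=> j /eqi; rewrite !mnmDE => ->.
Qed.

Lemma lvP m (k : 'I_n) :
  reflect ((0 < m k)%N /\ forall j : 'I_n, (j < k)%N -> m j = 0%N)
          (lv m == Some k).
Proof.
rewrite /lv; case: pickP => [i /andP[mi /forallP mj]|none]; last first.
  apply: (iffP idP) => // -[mk mj]; move: (none k); rewrite mk /= => /negbT.
  by case/forallPn => j; rewrite negb_imply => /andP[/mj->]; rewrite eqxx.
have mj0 (j : 'I_n) : (j < i)%N -> m j = 0%N.
  by move=> ltji; apply/eqP; move: (mj j); rewrite ltji.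
apply: (iffP eqP) => [[<-] //|[mk mjk]]; congr Some; apply: val_inj => /=.
case: (ltngtP i k) => // [/mjk|/mj0] e; first by rewrite e in mi.
by rewrite e in mk.
Qed.

Lemma lv_exists m : m != 0%MM -> exists k, lv m == Some k.
Proof.
move=> m0; have [i mi] : exists i, (0 < m i)%N.
  apply/existsP; apply: contraNT m0 => /existsPn m0.
  apply/eqP/mnmP => i; rewrite mnm0E; apply/eqP.
  by rewrite -leqn0 leqNgt.
case: (arg_minnP (P := fun i => (0 < m i)%N) (@nat_of_ord n) mi) => k mk mink.
exists k; apply/lvP; split => // j ltjk; apply/eqP; rewrite -leqn0 leqNgt.
by apply: contraL ltjk => /mink; rewrite -leqNgt.
Qed.

Lemma mnmU_subK m k : (0 < m k)%N -> (U_(k) + (m - U_(k)) = m)%MM.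
Proof. by move=> mk; rewrite addmC submK // lep1mP -lt0n. Qed.

Lemma mem_monomials_le d m : (m \in monomials_le n d) = (mdeg m <= d)%N.
Proof.
apply/mapP/idP => [[u _ ->]|led]; first by rewrite -ltnS bmdeg.
by exists (BMultinom (led : mdeg m < d.+1)%N); rewrite ?mem_enum.
Qed.

(** * Negative degree-lexicographic order *)

Definition ndeglex_lt m m' : bool :=
  (mdeg m < mdeg m')%N || ((mdeg m == mdeg m') && lex_lt m' m).

Lemma ndeglex_ltNge m m' : ndeglex_lt m m' = ~~ ndeglex_le m' m.
Proof.
rewrite /ndeglex_lt /ndeglex_le lex_ltNge eq_sym.
by case: (ltngtP (mdeg m) (mdeg m')).
Qed.

Lemma ndeglex_ltxx m : ndeglex_lt m m = false.
Proof. by rewrite /ndeglex_lt ltnn lex_ltxx andbF. Qed.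

Lemma ndeglex_lt_trans : transitive ndeglex_lt.
Proof.
move=> m2 m1 m3 /orP[lt12|/andP[/eqP e12 l21]] /orP[lt23|/andP[/eqP e23 l32]].
- by rewrite /ndeglex_lt (ltn_trans lt12).
- by rewrite /ndeglex_lt -e23 lt12.
- by rewrite /ndeglex_lt e12 lt23.
- by rewrite /ndeglex_lt e12 e23 eqxx (lex_lt_trans l32 l21) orbT.
Qed.

Lemma ndeglex_le_total : total (@ndeglex_le n).
Proof.
move=> m m'; rewrite /ndeglex_le.
by case: (ltngtP (mdeg m) (mdeg m')) => //= _; exact: lex_le_total.
Qed.

Lemma ndeglex_le_trans : transitive (@ndeglex_le n).
Proof.
move=> m2 m1 m3 /orP[lt12|/andP[/eqP e12 l21]] /orP[lt23|/andP[/eqP e23 l32]].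
- by rewrite /ndeglex_le (ltn_trans lt12).
- by rewrite /ndeglex_le -e23 lt12.
- by rewrite /ndeglex_le e12 lt23.
- by rewrite /ndeglex_le e12 e23 eqxx (lex_le_trans l32 l21) orbT.
Qed.

(* Only finitely many monomials of degree at most [d] exist, so the induction
   may run from the last monomial to the first one. *)
Lemma ndeglex_ind d (P : 'X_{1..n} -> Prop) :
  (forall m, (forall m', (mdeg m' <= d)%N -> ndeglex_lt m m' -> P m') -> P m) ->
  forall m, P m.
Proof.
move=> IH m; pose A m := [set u : 'X_{1..n < d.+1} | ndeglex_lt m u].
have [N] := ubnP #|A m|; elim: N m => // N IHN m ltN; apply: IH => m' dm' ltm.
apply: IHN; rewrite ltnS in ltN; apply: leq_trans ltN.
apply/proper_card/properP; split.
  by apply/subsetP => u; rewrite !inE; exact: ndeglex_lt_trans.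
exists (BMultinom (dm' : mdeg m' < d.+1)%N); rewrite !inE //=.
by rewrite ndeglex_ltxx.
Qed.

End Lex.

(** * The order ideal and its key monomials *)

(** Variables are stripped one at a time: [x_j] itself while its exponent is at least 2, otherwise
    another variable, which exists because the degree still exceeds [d >= 1]. *)
Lemma submonomial_of_degree n (u : 'X_{1..n}) j d :
  (0 < u j)%N -> (0 < d <= mdeg u)%N ->
  exists u', [/\ (u' <= u)%MM, (0 < u' j)%N & mdeg u' = d].
Proof.
move=> uj /andP[d0 led]; have [c] := ubnP (mdeg u).
elim: c u uj led => // c IH u uj led ltc.
case: (ltngtP d (mdeg u)) led => // [ltd _|-> _]; last first.
  by exists u; split=> //; exact: lepm_refl.
suff [i ui uij] : exists2 i, (0 < u i)%N & (0 < (u - U_(i))%MM j)%N.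
  have degu : mdeg u = (mdeg (u - U_(i))%MM).+1.
    by rewrite -{1}(mnmU_subK ui) mdegD mdeg1.
  have [||u' [le' uj' du']] := IH _ uij; [lia|lia|].
  by exists u'; split => //; exact: lepm_trans le' (lem_subr _ _).
have [uj1|uj1] := ltnP 1 (u j).
  by exists j; rewrite ?mnmBE ?mnm1E ?eqxx /= ?subn_gt0.
have [i /andP[ij ui]] : exists i, (i != j) && (0 < u i)%N.
  apply/existsP; apply: contraTT ltd => /existsPn u0.
  rewrite -leqNgt mdegE (bigD1 j) //= big1 => [|i ij]; first by lia.
  by have := u0 i; rewrite ij; lia.
by exists i => //; rewrite mnmBE mnm1E (negbTE ij) subn0.
Qed.

Section OrderIdeal.

Variables (n r s : nat) (W : nat -> 'X_{1..n.+1}).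
Hypothesis adm : admissible r s W.

Local Notation O := (order_ideal r s W).
Local Notation monomial := 'X_{1..n.+1}.
Implicit Types (m u t v w b : monomial) (i j k : 'I_n.+1).

Let ltrs : (r < s)%N. Proof. by case: adm => -[]. Qed.
Let r_ge2 : (2 <= r)%N. Proof. by case: adm => -[]. Qed.

Lemma mem_order_ideal m :
  (m \in O) = (mdeg m < r)%N || ((mdeg m <= s)%N && lex_lt m (W (mdeg m))).
Proof.
rewrite mem_filter mem_monomials_le /in_order_ideal.
case: (ltngtP (mdeg m) s.+1) => [lt|gt|eq].
- by rewrite [(mdeg m <= s)%N]lt !andbT.
- by rewrite andbF; lia.
- rewrite eq ltnn !andbT /=.
  (* A monomial below [x_n^(s+1)] can only differ from it first at the last variable, so its degree
     would be less than [s + 1]. Hence degree [s + 1] contributes nothing to [O]. *)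
  suff -> : lex_lt m (W s.+1) = false by rewrite orbF.
  have [_ _ -> _ _] := adm; apply/lex_ltP => -[i lti eqi].
  have i_max : i = ord_max.
    apply/eqP; apply: contraTT lti => ni.
    by rewrite mulmnE mnm1E eq_sym (negbTE ni) mul0n.
  move: eq lti; rewrite mulmnE mnm1E i_max eqxx mul1n mdegE big_ord_recr /=.
  rewrite big1 ?add0n => [->|j _].
    by rewrite ltnn.
  by rewrite eqi ?i_max //= mulmnE mnm1E -val_eqE /= gtn_eqF.
Qed.

Lemma order_ideal_mdeg m : m \in O -> (mdeg m <= s)%N.
Proof. by rewrite mem_order_ideal; lia. Qed.

Lemma notin_order_ideal_mdeg m : m \notin O -> (r <= mdeg m)%N.
Proof. by rewrite mem_order_ideal; lia. Qed.

Lemma order_ideal_lower m m' :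
  mdeg m = mdeg m' -> lex_le m m' -> m' \in O -> m \in O.
Proof.
rewrite !mem_order_ideal => -> le /orP[-> //|/andP[-> lt]].
by rewrite (lex_le_lt_trans le lt) orbT.
Qed.

(** If [m] has degree [d >= r], then [x_n m <= x_i m < W_(d+1) <= x_n W_d], and [x_n] cancels. *)
Lemma order_idealU i m : (U_(i) + m)%MM \in O -> m \in O.
Proof.
rewrite !mem_order_ideal mdegD mdeg1 add1n => /orP[|/andP[ltds lt]]; first by lia.
case: (ltnP (mdeg m) r) => //= led; rewrite (ltnW ltds) /=.
have [_ _ _ /(_ (mdeg m)) stepW _] := adm.
rewrite -(lex_lt_add2l U_(ord_max)%MM).
apply: (@lex_lt_le_trans _ (W (mdeg m).+1)); last by apply: stepW; rewrite led.
apply: lex_le_lt_trans lt; case: (eqVneq i ord_max) => [->|ni]; first exact: lex_lexx.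
apply/orP; right; apply/lex_ltP; exists i; rewrite ?mnmDE ?mnm1E ?eqxx.
  by rewrite (eq_sym ord_max) (negbTE ni).
move=> j ltji; rewrite !mnmDE !mnm1E -!val_eqE /= gtn_eqF ?gtn_eqF //.
by rewrite (leq_trans ltji) // -ltnS.
Qed.

Lemma order_ideal_dvd m m' : (m <= m')%MM -> m' \in O -> m \in O.
Proof.
move=> le; rewrite -(submK le); move: (m' - m)%MM => u.
have [d] := ubnP (mdeg u); elim: d u => // d IH u ltu.
case: (eqVneq u 0%MM) => [->|]; first by rewrite add0m.
case/lv_exists => i /lvP[ui _]; rewrite -(mnmU_subK ui) -addmA => /order_idealU.
by apply: IH; move: ltu; rewrite -{1}(mnmU_subK ui) mdegD mdeg1.
Qed.

Lemma zero_in_order_ideal : 0%MM \in O.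
Proof. by rewrite mem_order_ideal mdeg0; lia. Qed.

Lemma last_var_power_in_order_ideal d : (d <= s)%N -> (U_(ord_max) *+ d)%MM \in O.
Proof.
move=> leds; apply: (@order_ideal_dvd _ (U_(ord_max) *+ s)%MM).
  by apply/mnm_lepP => i; rewrite !mulmnE leq_mul2l leds orbT.
rewrite mem_order_ideal mdegMn mdeg1 mul1n leqnn.
by have [_ _ _ _ ->] := adm; rewrite orbT.
Qed.

Lemma mem_border b :
  (b \in border O) = (b \notin O) && [exists k, (0 < b k)%N && ((b - U_(k))%MM \in O)].
Proof.
rewrite mem_undup mem_filter; congr (_ && _).
apply/allpairsP/existsP => [[[k t] /= [_ tO ->]]|[k /andP[bk bO]]].
  by exists k; rewrite mnmDE mnm1E eqxx /= addmC addmK.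
by exists (k, (b - U_(k))%MM); rewrite mem_enum /= mnmU_subK.
Qed.

(** Minimality already puts [b] on the border: [b] is not 1, so some variable divides it, with
    quotient in [O]. *)
Lemma mem_LM b : (b \in LM r s W) = [&& b \notin O, (mdeg b <= s)%N &
  [forall k : 'I_n.+1, (0 < b k)%N ==> ((b - U_(k))%MM \in O)]].
Proof.
rewrite mem_filter mem_border.
apply/andP/and3P => [[/andP[-> ->] /andP[]] //|[bO -> minb]].
split=> //; rewrite bO /=.
have /lv_exists[k /lvP[bk _]] : b != 0%MM.
  by apply: contraNneq bO => ->; exact: zero_in_order_ideal.
by apply/existsP; exists k; rewrite bk; exact: (implyP (forallP minb k)).
Qed.

Lemma LM_notin b : b \in LM r s W -> b \notin O.
Proof. by rewrite mem_LM => /andP[]. Qed.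

Lemma LM_mdeg b : b \in LM r s W -> (mdeg b <= s)%N.
Proof. by rewrite mem_LM => /and3P[]. Qed.

Lemma LM_border b : b \in LM r s W -> b \in border O.
Proof. by rewrite mem_filter => /andP[]. Qed.

Lemma notin_LMU i m : m \notin O -> (U_(i) + m)%MM \notin LM r s W.
Proof.
move=> mO; rewrite mem_LM !negb_and; apply/or3P/Or33/forallPn.
by exists i; rewrite mnmDE mnm1E eqxx addmC addmK.
Qed.

(** Dividing by variables while staying outside [O] must stop, and it stops at an element of
    [LM]. *)
Lemma LM_divisor m : m \notin O -> (mdeg m <= s)%N ->
  exists2 b, b \in LM r s W & (b <= m)%MM.
Proof.
have [d] := ubnP (mdeg m); elim: d m => // d IH m ltd mO les.
have [minm|] := boolP [forall k : 'I_n.+1, (0 < m k)%N ==> ((m - U_(k))%MM \in O)].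
  by exists m; rewrite ?lepm_refl // mem_LM mO les.
case/forallPn => k; rewrite negb_imply => /andP[mk mkO].
have dm : mdeg m = (mdeg (m - U_(k))%MM).+1.
  by rewrite -{1}(mnmU_subK mk) mdegD mdeg1.
have [||b bLM le] := IH _ _ mkO; [lia|lia|].
by exists b => //; exact: lepm_trans le (lem_subr _ _).
Qed.

(** A divisor [u'] of [u] with the degree of [m] that keeps the factor [x_j] involves a variable
    larger than all those of [m]. It is therefore lex-larger than [m], and having it in [O] would
    force [m] into [O]. *)
Lemma notin_larger_var m k j u : m \notin O -> lv m == Some k ->
  (j < k)%N -> (0 < u j)%N -> (mdeg m <= mdeg u)%N -> u \notin O.
Proof.
move=> mO /lvP[mk m0] ltjk uj ledeg.
have [|u' [le' uj' du']] := submonomial_of_degree uj (d := mdeg m).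
  by rewrite ledeg andbT; have := notin_order_ideal_mdeg mO; lia.
apply: contra mO => /(order_ideal_dvd le') u'O.
apply: order_ideal_lower u'O => //; rewrite ?du' //.
have /lv_exists[i /lvP[ui u0]] : u' != 0%MM.
  by apply: contraTneq uj' => ->; rewrite mnm0E.
apply/orP; right; apply/lex_ltP; exists i => [|l ltl]; last rewrite u0 //.
  rewrite m0 //; apply: leq_ltn_trans ltjk; rewrite leqNgt.
  by apply/negP => /u0 e; rewrite e in uj'.
apply: m0; apply: ltn_trans ltl (leq_ltn_trans _ ltjk).
by rewrite leqNgt; apply/negP => /u0 e; rewrite e in uj'.
Qed.

(** By [notin_larger_var], [x_j] times a power of [x_n] of the degree of [m] lies outside [O]. A
    divisor of it in [LM] must contain [x_j], since the powers of [x_n] of degree at most [s] are in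
    [O]. *)
Lemma larger_var_LM m k j : m \notin O -> (mdeg m <= s)%N -> lv m == Some k ->
  (j < k)%N -> exists p, (U_(j) + U_(ord_max) *+ p)%MM \in LM r s W.
Proof.
move=> mO les lvm ltjk; pose u : monomial := (U_(j) + U_(ord_max) *+ (mdeg m).-1)%MM.
have m_ge2 : (2 <= mdeg m)%N by exact: leq_trans (notin_order_ideal_mdeg mO).
have jmax : (j == ord_max) = false.
  by rewrite -val_eqE /= ltn_eqF // (leq_trans ltjk) // -ltnS.
have du : mdeg u = mdeg m by rewrite mdegD mdegMn !mdeg1 mul1n; lia.
have uO : u \notin O.
  apply: (notin_larger_var mO lvm ltjk); last by rewrite du.
  by rewrite mnmDE mnm1E eqxx.
have [|b bLM /mnm_lepP le] := LM_divisor uO; first by rewrite du.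
have b0 i : i != j -> i != ord_max -> b i = 0%N.
  move=> ij imax; have := le i; rewrite mnmDE mulmnE !mnm1E eq_sym (negbTE ij).
  by rewrite eq_sym (negbTE imax) mul0n leqn0 => /eqP.
have bj : b j = 1%N.
  have := le j; rewrite mnmDE mulmnE !mnm1E eqxx eq_sym jmax mul0n.
  case: (posnP (b j)) => [bj _|]; last by lia.
  have bE : b = (U_(ord_max) *+ b ord_max)%MM.
    apply/mnmP => i; rewrite mulmnE mnm1E eq_sym.
    case: (eqVneq i ord_max) => [->|imax]; first by rewrite mul1n.
    by rewrite mul0n; case: (eqVneq i j) => [->//|ij]; exact: b0.
  have := LM_notin bLM; rewrite bE last_var_power_in_order_ideal //.
  apply: leq_trans (LM_mdeg bLM).
  by rewrite mdegE (bigD1 ord_max) //= leq_addr.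
exists (b ord_max); suff <- : b = (U_(j) + U_(ord_max) *+ b ord_max)%MM by [].
apply/mnmP => i; rewrite mnmDE mulmnE !mnm1E [j == i]eq_sym [ord_max == i]eq_sym.
case: (eqVneq i j) => [->|ij]; first by rewrite jmax bj.
by case: (eqVneq i ord_max) => [->|imax]; [rewrite mul1n|rewrite mul0n b0].
Qed.

Lemma lv_var_last_power j p : (j < n)%N ->
  let b : monomial := (U_(j) + U_(ord_max) *+ p)%MM in lv b == Some j /\ b j = 1%N.
Proof.
move=> ltjn /=; have bj : (U_(j) + U_(ord_max) *+ p)%MM j = 1%N.
  by rewrite mnmDE mulmnE !mnm1E eqxx -val_eqE /= gtn_eqF.
split=> //; apply/lvP; rewrite bj; split=> // i ltij.
by rewrite mnmDE mulmnE !mnm1E -!val_eqE /= gtn_eqF // gtn_eqF // (ltn_trans ltij).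
Qed.

(** A divisor of [m] in [LM] has no variable larger than [x_k]; if it has only smaller ones,
    [larger_var_LM] supplies an element led by [x_k]. *)
Lemma exists_LM_lv m k : m \notin O -> (mdeg m <= s)%N -> lv m == Some k ->
  exists2 b, b \in LM r s W & lv b == Some k.
Proof.
move=> mO les /[dup] lvm /lvP[mk m0]; have [b bLM /mnm_lepP le] := LM_divisor mO les.
have /lv_exists[l /[dup] lvb /lvP[bl b0]] : b != 0%MM.
  by apply: contraNneq (LM_notin bLM) => ->; exact: zero_in_order_ideal.
have [ltkl|ltlk|/val_inj ekl] := ltngtP k l; last by exists b; rewrite ?ekl.
- have [p pLM] := larger_var_LM (LM_notin bLM) (LM_mdeg bLM) lvb ltkl.
  exists (U_(k) + U_(ord_max) *+ p)%MM => //.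
  by have [] := lv_var_last_power p (leq_trans ltkl (ltn_ord l : (l <= n)%N)).
- by have := le l; rewrite m0 // leqNgt bl.
Qed.

Lemma is_keyP k : reflect (exists2 m, m \notin O & (mdeg m <= s)%N /\ lv m == Some k)
  (is_key r s W k).
Proof.
apply: (iffP hasP) => [[m]|[m mO [les lvm]]].
  by rewrite mem_filter => /andP[/andP[_ mO] _] /andP[les lvm]; exists m.
exists m; rewrite ?les // mem_filter mO notin_order_ideal_mdeg //.
by rewrite mem_monomials_le leqW.
Qed.

(** * Key monomials and target seeds *)

Local Notation chi := (key_mono r s W).
Local Notation ke := (key_exp r s W).
Local Notation kc := (key_cofactor r s W).

(** By [exists_LM_lv] the sorted list is nonempty, so its head is a true minimum and not the default
    value. *)
Lemma key_monoP k : is_key r s W k ->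
  [/\ chi k \in LM r s W, lv (chi k) == Some k &
      forall b, b \in LM r s W -> lv b == Some k -> lex_le (chi k) b].
Proof.
case/is_keyP => m mO [les /(exists_LM_lv mO les)[b bLM lvb]].
rewrite /key_mono; set l := filter _ _.
have mem_l u : (u \in sort (@lex_le n.+1) l) = (lv u == Some k) && (u \in LM r s W).
  by rewrite mem_sort mem_filter.
have := sort_sorted (@lex_le_total n.+1) l.
case: (sort _ l) mem_l => [/(_ b)|x l' mem_l path_l]; first by rewrite lvb bLM.
have /andP[lvx xLM] : (lv x == Some k) && (x \in LM r s W) by rewrite -mem_l mem_head.
split => //= u uLM lvu; have : u \in x :: l' by rewrite mem_l lvu.
rewrite inE => /orP[/eqP->|]; first exact: lex_lexx.
by apply: (allP (order_path_min (@lex_le_trans _) path_l)).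
Qed.

Lemma lex_le_lv_exp k m m' : lv m == Some k -> lv m' == Some k -> lex_le m m' ->
  (m k <= m' k)%N.
Proof.
move=> /lvP[mk m0] /lvP[mk' m0'] /orP[/eqP-> //|/lex_ltP[i lti eqi]].
have [ltki|ltik|/val_inj->] := ltngtP k i; [by rewrite eqi| |exact: ltnW].
by rewrite m0' in lti.
Qed.

Lemma key_exp_gt0 k : is_key r s W k -> (0 < ke k)%N.
Proof. by case/key_monoP => _ /lvP[]. Qed.

Lemma key_mono_split k : (U_(k) *+ ke k + kc k)%MM = chi k.
Proof.
rewrite addmC submK //; apply/mnm_lepP => i; rewrite mulmnE mnm1E.
by case: eqP => [<-|]; rewrite ?mul1n ?mul0n.
Qed.

Lemma mdeg_key_mono k : mdeg (chi k) = (ke k + mdeg (kc k))%N.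
Proof. by rewrite -(key_mono_split k) mdegD mdegMn mdeg1 mul1n. Qed.

(** [larger_var_LM] gives an element of [LM] in which the leading variable [x_j] has exponent 1, and
    the lex-minimal [chi j] has an exponent no larger. *)
Lemma key_exp_larger_var m k j : m \notin O -> (mdeg m <= s)%N ->
  lv m == Some k -> (j < k)%N -> ke j = 1%N.
Proof.
move=> mO les lvm ltjk; have [p pLM] := larger_var_LM mO les lvm ltjk.
have [lvb bj] := lv_var_last_power p (leq_trans ltjk (ltn_ord k : (k <= n)%N)).
have keyj : is_key r s W j.
  by apply/is_keyP; exists (U_(j) + U_(ord_max) *+ p)%MM; rewrite ?LM_notin ?LM_mdeg.
have [_ lvchi /(_ _ pLM lvb) lechi] := key_monoP keyj.
have := lex_le_lv_exp lvchi lvb lechi; rewrite bj.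
by have := key_exp_gt0 keyj; rewrite /key_exp; lia.
Qed.

(** Ensures that the truncated subtraction in [initial_target] is a true division. A divisor of [m]
    in [LM] is either led by [x_k], and minimality of [chi k] bounds [e_k], or led by a smaller
    variable, and then [e_k = 1]. *)
Lemma key_exp_le m k : m \notin O -> (mdeg m <= s)%N -> lv m == Some k ->
  (ke k <= m k)%N.
Proof.
move=> mO les /[dup] lvm /lvP[mk m0]; have [b bLM /mnm_lepP le] := LM_divisor mO les.
have /lv_exists[l /[dup] lvb /lvP[bl b0]] : b != 0%MM.
  by apply: contraNneq (LM_notin bLM) => ->; exact: zero_in_order_ideal.
have keyk : is_key r s W k by apply/is_keyP; exists m.
have [ltkl|ltlk|/val_inj ekl] := ltngtP k l.
- by rewrite (key_exp_larger_var (LM_notin bLM) (LM_mdeg bLM) lvb ltkl).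
- by have := le l; rewrite m0 // leqNgt bl.
- have [_ lvchi /(_ b bLM)] := key_monoP keyk; rewrite -ekl in lvb => /(_ lvb) lechi.
  exact: leq_trans (lex_le_lv_exp lvchi lvb lechi) (le k).
Qed.

Lemma key_divide m k : m \notin O -> (mdeg m <= s)%N -> lv m == Some k ->
  ((m - U_(k) *+ ke k) + U_(k) *+ ke k = m)%MM.
Proof.
move=> mO les lvm; rewrite submK //; apply/mnm_lepP => i; rewrite mulmnE mnm1E.
by case: eqP => [<-|]; rewrite ?mul1n ?mul0n // key_exp_le.
Qed.

(** [key_monoP] puts [chi k] in [LM], so [t] avoids [TM]; this is what makes the bound by [s]
    strict. *)
Lemma target_seedsP k q : q \in target_seeds r s W k ->
  is_key r s W k /\
  exists t, [/\ t \in O, (mdeg (chi k) <= mdeg t < s)%N & (q + kc k = t)%MM].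
Proof.
rewrite /target_seeds; case: ifP => // keyk /mapP[t].
rewrite mem_filter => /andP[/and3P[ledeg le]]; have [-> _ _] := key_monoP keyk.
move=> /= tTM tO ->; split=> //; exists t; split => //; last by rewrite submK.
rewrite ledeg ltn_neqAle order_ideal_mdeg // andbT.
by move: tTM; rewrite mem_filter tO andbT.
Qed.

Lemma mdeg_target_seed k q : q \in target_seeds r s W k -> (ke k <= mdeg q)%N.
Proof.
case/target_seedsP => keyk [t [tO /andP[ledeg _] e]].
by move: ledeg; rewrite -e mdeg_key_mono mdegD leq_add2r.
Qed.

(** Otherwise [t], whose degree is at least that of [chi k], would contain a variable larger than
    [x_k] and leave [O] by [notin_larger_var]. *)
Lemma target_seed_small k q i : q \in target_seeds r s W k -> (i < k)%N -> q i = 0%N.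
Proof.
case/target_seedsP => /key_monoP[chiLM lvchi _] [t [tO /andP[ledeg _] e]] ltik.
suff : t i = 0%N by rewrite -e mnmDE => /eqP; rewrite addn_eq0 => /andP[/eqP].
apply/eqP; rewrite -leqn0 leqNgt; apply/negP => ti.
by have := notin_larger_var (LM_notin chiLM) lvchi ltik ti ledeg; rewrite tO.
Qed.

(** Multiplying by the cofactor turns the comparison into one between [chi k], outside [O], and [t]
    in [O]: in equal degree, [t] is lex-smaller. All descending inductions below rest on this. *)
Lemma target_seed_after k q v : q \in target_seeds r s W k ->
  ndeglex_lt (v + U_(k) *+ ke k)%MM (v + q)%MM.
Proof.
move=> /[dup] qk /target_seedsP[/key_monoP[chiLM _ _] [t [tO /andP[ledeg _] e]]].
rewrite /ndeglex_lt !mdegD !ltn_add2l eqn_add2l mdegMn mdeg1 mul1n lex_lt_add2l.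
have := mdeg_target_seed qk; rewrite leq_eqVlt => /orP[/eqP eq|->//].
apply/orP; right; rewrite -eq eqxx /= -(lex_lt_add2l (kc k)) addmC e addmC key_mono_split.
rewrite lex_ltNge; apply/negP => le; have := LM_notin chiLM.
by rewrite (order_ideal_lower _ le) // -e mdegD mdeg_key_mono eq.
Qed.

End OrderIdeal.

(** * Border bases from normal form maps *)

Section MonomialLift.

Variables (n : nat) (R : nzRingType) (V : lmodType R) (h : 'X_{1..n} -> V).
Implicit Types p : {mpoly R[n]}.

(** The linear extension of [h], in the shape of [border_reduce] and [subst_targets], which are thus
    instances by conversion. *)
Definition mono_lift p : V := \sum_(m <- msupp p) p@_m *: h m.

Lemma mono_liftE p d : (msize p <= d)%N ->
  mono_lift p = \sum_(m : 'X_{1..n < d}) p@_m *: h m.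
Proof.
move=> led; set I : subFinType _ := 'X_{1..n < d}.
rewrite /mono_lift (big_mksub I) ?msupp_uniq //=; first last.
  by move=> x /msize_mdeg_lt /leq_trans; apply.
by rewrite big_rmcond //= => m /memN_msupp_eq0 ->; rewrite scale0r.
Qed.

Lemma mono_lift_linear : linear mono_lift.
Proof.
move=> a p q; set d := maxn (msize (a *: p + q)) (maxn (msize p) (msize q)).
rewrite !(@mono_liftE _ d) ?leq_max ?leqnn ?orbT // scaler_sumr -big_split /=.
by apply: eq_bigr => m _; rewrite mcoeffD mcoeffZ scalerDl scalerA.
Qed.

HB.instance Definition _ :=
  GRing.isLinear.Build R {mpoly R[n]} V _ mono_lift mono_lift_linear.

Lemma mono_liftX m : mono_lift 'X_[m] = h m.
Proof. by rewrite /mono_lift msuppX big_seq1 mcoeffX eqxx scale1r. Qed.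

End MonomialLift.

(** * The border basis attached to a normal form map *)

Section NormalForm.

Variables (R : comNzRingType) (n : nat) (O : seq 'X_{1..n}).
Variable phi : {linear {mpoly R[n]} -> {mpoly R[n]}}.
Hypothesis O0 : 0%MM \in O.
Hypothesis phiO : forall t, t \in O -> phi 'X_[t] = 'X_[t].
Hypothesis phi_supp : forall p m, m \notin O -> (phi p)@_m = 0.
(* This makes the kernel of [phi] an ideal. *)
Hypothesis phiX : forall i m, phi ('X_i * 'X_[m]) = phi ('X_i * phi 'X_[m]).

Implicit Types p q f : {mpoly R[n]}.

Lemma sum_supported p : (forall m, m \notin O -> p@_m = 0) ->
  \sum_(t : seq_sub O) p@_(val t) *: 'X_[val t] = p.
Proof.
move=> p0; apply/mpolyP => m; rewrite raddf_sum /=.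
have [mO|mO] := boolP (m \in O); last first.
  rewrite p0 // big1 // => t _; rewrite mcoeffZ mcoeffX.
  by case: eqP => [e|]; rewrite ?mulr0 // p0 ?mul0r // e.
rewrite (bigD1 (SeqSub mO)) //= mcoeffZ mcoeffX eqxx mulr1 big1 ?addr0 // => t nt.
by rewrite mcoeffZ mcoeffX -(inj_eq val_inj) in nt *; rewrite (negbTE nt) mulr0.
Qed.

Lemma nf_supported p : (forall m, m \notin O -> p@_m = 0) -> phi p = p.
Proof.
move=> p0; rewrite {1}(mpolyE p) {3}(mpolyE p) linear_sum !big_seq /=.
apply: eq_bigr => m mp; rewrite linearZ /= phiO //.
by apply: contraLR mp => /p0 /eqP; rewrite mcoeff_eq0.
Qed.

Lemma nfK p : phi (phi p) = phi p.
Proof. by apply: nf_supported => m; exact: phi_supp. Qed.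

(** [phiX] extends by linearity to ['X_i * f], then to monomial multipliers by induction on the
    degree, then to all [p] by linearity. *)
Lemma nf_mul p q : phi (p * q) = phi (p * phi q).
Proof.
have nfXm i f : phi ('X_i * f) = phi ('X_i * phi f).
  rewrite (mpolyE f) linear_sum !mulr_sumr !linear_sum /=.
  by apply: eq_bigr => m _; rewrite linearZ /= -!scalerAr !linearZ /= phiX.
have nfX u f : phi ('X_[u] * f) = phi ('X_[u] * phi f).
  have [d] := ubnP (mdeg u); elim: d u f => // d IH u f ltd.
  have [->|] := eqVneq u 0%MM; first by rewrite mpolyX0 !mul1r nfK.
  case/lv_exists => i /lvP[ui _]; rewrite -(mnmU_subK ui) mpolyXD -!mulrA nfXm.
  rewrite [in RHS]nfXm; congr (phi (_ * _)); apply: IH.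
  by move: ltd; rewrite -{1}(mnmU_subK ui) mdegD mdeg1.
rewrite (mpolyE p) !mulr_suml !linear_sum /=.
by apply: eq_bigr => m _; rewrite -!scalerAl !linearZ /= nfX.
Qed.

Variable G : seq_sub (border O) -> {mpoly R[n]}.
Hypothesis GE : forall b, G b = 'X_[val b] - phi 'X_[val b].

Local Notation inG := (ideal_gen (fun g => exists b, g = G b)).

Lemma inG_nf f : inG f -> phi f = 0.
Proof.
case=> l [lG ->]; rewrite linear_sum big_seq big1 // => p /lG[b ->].
by rewrite nf_mul GE linearB /= nfK subrr mulr0 linear0.
Qed.

Lemma inG0 : inG 0.
Proof. by exists [::]; rewrite big_nil. Qed.

Lemma inG_sum (I : Type) (l : seq I) (P : pred I) (F : I -> {mpoly R[n]}) :
  (forall i, P i -> inG (F i)) -> inG (\sum_(i <- l | P i) F i).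
Proof.
move=> HF; elim/big_rec: _ => [|i x Pi Hx]; first exact: inG0.
by rewrite -[F i]mul1r; apply: ideal_genD => //; exact: HF.
Qed.

Lemma inG_mul p f : inG f -> inG (p * f).
Proof. by move=> fG; rewrite -[_ * f]addr0; apply: ideal_genD => //; exact: inG0. Qed.

Lemma inG_sub_nfX m : (m \in O) || (m \in border O) -> inG ('X_[m] - phi 'X_[m]).
Proof.
have [mO _|mO /= mB] := boolP (m \in O).
  by rewrite phiO // subrr; exact: inG0.
exists [:: (1, G (SeqSub mB))]; rewrite big_seq1 mul1r GE; split => // p.
by rewrite inE => /eqP->; exists (SeqSub mB).
Qed.

Lemma order_idealU_border i t : t \in O ->
  ((U_(i) + t)%MM \in O) || ((U_(i) + t)%MM \in border O).
Proof.
move=> tO; case: (boolP (_ \in O)) => //= uO.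
rewrite mem_undup mem_filter uO; apply/allpairsP; exists (i, t).
by rewrite mem_enum.
Qed.

(** Induction on the degree: [x_i g - phi (x_i g)] is [x_i (g - phi g)] plus
    [x_i phi g - phi (x_i phi g)], and the latter only involves monomials [x_i t] with [t] in [O],
    which lie in [O] or on the border. *)
Lemma inG_sub_nf f : inG (f - phi f).
Proof.
have inX m : inG ('X_[m] - phi 'X_[m]).
  have [d] := ubnP (mdeg m); elim: d m => // d IH m ltd.
  have [->|] := eqVneq m 0%MM; first by apply: inG_sub_nfX; rewrite O0.
  case/lv_exists => i /lvP[mi _]; rewrite -(mnmU_subK mi) mpolyXD phiX.
  have /IH : (mdeg (m - U_(i))%MM < d)%N.
    by move: ltd; rewrite -{1}(mnmU_subK mi) mdegD mdeg1.
  set g := 'X_[_] => gG; rewrite -(subrK ('X_i * phi g) ('X_i * g)) -mulrBr -addrA.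
  apply: ideal_genD => //; rewrite -(sum_supported (phi_supp g)).
  rewrite mulr_sumr linear_sum -sumrB; apply: inG_sum => t _.
  rewrite -scalerAr linearZ -scalerBr -mul_mpolyC -mpolyXD.
  by apply/inG_mul/inG_sub_nfX/order_idealU_border/ssvalP.
rewrite (mpolyE f) linear_sum -sumrB; apply: inG_sum => m _.
by rewrite linearZ -scalerBr -mul_mpolyC; exact: inG_mul.
Qed.

Lemma nf_border_basis : is_border_basis G.
Proof.
split=> [b m|f].
  rewrite GE [_ - _ - _]addrAC subrr sub0r mcoeff_msupp mcoeffN oppr_eq0.
  by apply: contraNT => /(phi_supp 'X_[val b]) ->.
exists [ffun t => (phi f)@_(val t)]; split=> [|a /inG_nf].
  under eq_bigr do rewrite ffunE.
  by rewrite sum_supported //; [exact: inG_sub_nf|exact: phi_supp].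
(* Uniqueness: [phi] kills the ideal and fixes the span of [O], so the coefficients [a] are those of
   [phi f]. *)
rewrite linearB /= => /eqP; rewrite subr_eq0 => /eqP->; apply/ffunP => t.
rewrite ffunE nf_supported => [|m mO]; rewrite raddf_sum /=; last first.
  rewrite big1 // => u _; rewrite mcoeffZ mcoeffX.
  by case: eqP mO => [<-|]; rewrite ?mulr0 // (ssvalP u).
rewrite (bigD1 t) //= mcoeffZ mcoeffX eqxx mulr1 big1 ?addr0 // => u nu.
by rewrite mcoeffZ mcoeffX (inj_eq val_inj) (negbTE nu) mulr0.
Qed.

End NormalForm.

(** * The comorphism out of the coordinate ring of the scheme *)

Section Comorphism.

Variables (K : fieldType) (n : nat) (O : seq 'X_{1..n}).

Local Notation CR := {mpoly K[seq_sub O * seq_sub (border O)]^fin}.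

(** [xi] evaluates a chosen representative; two representatives differ by an element of the ideal,
    on which [ev] vanishes. *)
Lemma scheme_comorphism (R : comAlgType K) (ev : {lrmorphism CR -> R}) :
  (forall p, scheme_gen p -> ev p = 0) ->
  exists xi : {lrmorphism scheme_ring O K -> R},
    forall p, xi (scheme_proj p) = ev p.
Proof.
move=> ev0.
have ev_ideal p : p \in @scheme_ideal n O K -> ev p = 0.
  case/asboolP => l [lS ->]; rewrite rmorph_sum big_seq big1 // => q /lS /ev0.
  by rewrite rmorphM /= => ->; rewrite mulr0.
pose xi (x : scheme_ring O K) : R := ev (repr (x : {ideal_quot @scheme_ideal n O K})).
have xiE p : xi (scheme_proj p) = ev p.
  apply/eqP; rewrite -subr_eq0 -rmorphB; apply/eqP/ev_ideal.
  rewrite Quotient.idealrBE reprK; exact/eqP.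
have projK x : scheme_proj (repr (x : {ideal_quot @scheme_ideal n O K})) = x.
  exact: reprK.
have xi_lin : linear xi.
  move=> a x y; rewrite -[x]projK -[y]projK !xiE.
  have -> : a *: scheme_proj (repr x) = scheme_proj (a *: repr x).
    by rewrite -mul_mpolyC scheme_projM.
  by rewrite -scheme_projD xiE linearP.
have xi_mul : monoid_morphism xi.
  split; first by rewrite -scheme_proj1 xiE rmorph1.
  by move=> x y; rewrite -[x]projK -[y]projK -scheme_projM !xiE rmorphM.
pose xiL := GRing.isLinear.Build K (scheme_ring O K) R _ xi xi_lin.
pose xiM := GRing.isMonoidMorphism.Build (scheme_ring O K) R xi xi_mul.
pose xiLR : {lrmorphism scheme_ring O K -> R} := HB.pack xi xiL xiM.
by exists xiLR.
Qed.

(** Under [ev], the two halves of a reduced S-polynomial become [phi] of [x_k b] and of [x_l b'],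
    which are the same monomial, so every generator of the scheme ideal is sent to 0. *)
Lemma nf_comorphism (R : comAlgType K) (phi : {linear {mpoly R[n]} -> {mpoly R[n]}})
    (G : seq_sub (border O) -> {mpoly R[n]}) :
  0%MM \in O ->
  (forall t, t \in O -> phi 'X_[t] = 'X_[t]) ->
  (forall p m, m \notin O -> (phi p)@_m = 0) ->
  (forall i m, phi ('X_i * 'X_[m]) = phi ('X_i * phi 'X_[m])) ->
  (forall b, G b = 'X_[val b] - phi 'X_[val b]) ->
  exists xi : {lrmorphism scheme_ring O K -> R}, induced_comorphism G xi.
Proof.
move=> O0 phiO phi_supp phiX GE.
pose z (i : 'I_#|{: seq_sub O * seq_sub (border O)}|) : R :=
  - (G (enum_val i).2)@_(val (enum_val i).1).
have ev_scale : scalable (mmap (GRing.in_alg R) z).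
  by move=> a p; rewrite mmapZ /= mulr_algl.
pose evS := GRing.isScalable.Build K CR R _ (mmap (GRing.in_alg R) z) ev_scale.
pose ev : {lrmorphism CR -> R} := HB.pack (mmap (GRing.in_alg R) z) evS.
have evcG t b : ev (cvar K t b) = - (G b)@_(val t).
  by rewrite /ev /= mmapX mmap1U /z enum_rankK.
(* As [b] is not in [O], the leading term of [G b] does not reach the coefficient at [t]. *)
have evc t b : ev (cvar K t b) = (phi 'X_[val b])@_(val t).
  rewrite evcG GE mcoeffB mcoeffX.
  case: eqP => [e|_]; rewrite ?sub0r ?opprK //.
  have := ssvalP b; rewrite mem_undup mem_filter => /andP[].
  by rewrite [X in X \notin _]e (ssvalP t).
have [xi xiE] : exists xi : {lrmorphism scheme_ring O K -> R},
    forall p, xi (scheme_proj p) = ev p; last first.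
  by exists xi => t b; rewrite xiE evcG.
apply: scheme_comorphism => p [k [l [b [b' [t [_ e ->]]]]]].
rewrite -mcoeff_map_mpoly.
pose h m : {mpoly CR[n]} := if insub m is Some c
  then \sum_(t : seq_sub O) cvar K t c *: 'X_[val t] else 'X_[m].
have hE m : (m \in O) || (m \in border O) -> map_mpoly ev (h m) = phi 'X_[m].
  rewrite /h; case: insubP => [c cB <- _|mB]; last first.
    by rewrite (negbTE mB) orbF => mO; rewrite map_mpolyX phiO.
  rewrite raddf_sum -[RHS](sum_supported (phi_supp _)) /=.
  apply: eq_bigr => u _; rewrite map_mpolyZ map_mpolyX.
  by congr (_ *: _); exact: evc.
(* A single round of reduction suffices, since [x_j t] with [t] in [O] lies in [O] or on the
   border. *)
have reduceE (j : option 'I_n) (c : seq_sub (border O)) :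
    map_mpoly ev (mono_lift h
      ('X_[mvar0 j] * \sum_(t : seq_sub O) cvar K t c *: 'X_[val t]))
    = phi 'X_[(mvar0 j + val c)%MM].
  rewrite mpolyXD (nf_mul phiO phi_supp phiX) -(sum_supported (phi_supp 'X_[val c])).
  rewrite !mulr_sumr !linear_sum raddf_sum /=; apply: eq_bigr => u _.
  rewrite -!scalerAr !linearZ /= map_mpolyZ -!mpolyXD mono_liftX hE.
    by congr (_ *: _); exact: evc.
  case: j => [i|] /=; first exact/order_idealU_border/ssvalP.
  by rewrite add0m (ssvalP u).
have -> : spoly K k l b b'
    = 'X_[mvar0 l] * (\sum_(t : seq_sub O) cvar K t b' *: 'X_[val t])
    - 'X_[mvar0 k] * (\sum_(t : seq_sub O) cvar K t b *: 'X_[val t]).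
  by rewrite /spoly !mulrBr -!mpolyXD e opprB addrC addrA subrK.
have reduce_lift q : border_reduce q = mono_lift h q by [].
rewrite reduce_lift (linearB (mono_lift h)).
rewrite (raddfB (map_mpoly ev)) mcoeffB.
apply/eqP; rewrite subr_eq0; apply/eqP.
apply: etrans (congr1 _ (reduceE l b')) (etrans _ (esym (congr1 _ (reduceE k b)))).
by rewrite e.
Qed.

End Comorphism.

(** * The border basis MG *)

(** The image is a subalgebra containing every indeterminate. *)
Lemma mpoly_fin_surj (K : fieldType) (A : lalgType K) (T : finType)
    (xi : {lrmorphism A -> {mpoly K[T]^fin}}) :
  (forall t, exists x, xi x = mvar K t) -> forall y, exists x, xi x = y.
Proof.
move=> surjX y; rewrite (mpolyE y).
elim/big_rec: _ => [|m _ _ [x <-]]; first by exists 0; rewrite linear0.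
suff [u <-] : exists u, xi u = 'X_[m] by exists (y@_m *: u + x); rewrite linearP.
rewrite mpolyXE_id; elim/big_rec: _ => [|i _ _ [v <-]].
  by exists 1; rewrite rmorph1.
have [u xiu] := surjX (enum_val i); exists (u ^+ m i * v).
by rewrite rmorphM rmorphXn /= xiu /mvar enum_valK.
Qed.

Lemma linear_mul_sumZ (R : comNzRingType) (A : comAlgType R) (V : lmodType R)
    (f : {linear A -> V}) (I : finType) (c : I -> R) (g : I -> A) p :
  f (p * \sum_i c i *: g i) = \sum_i c i *: f (p * g i).
Proof.
rewrite mulr_sumr linear_sum; apply: eq_bigr => i _.
by rewrite -scalerAr linearZZ.
Qed.

Section Targets.

Variables (n r s : nat) (W : nat -> 'X_{1..n.+1}).
Hypothesis adm : admissible r s W.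
Variable K : fieldType.

Local Notation O := (order_ideal r s W).
Local Notation monomial := 'X_{1..n.+1}.
Local Notation R := {mpoly K[param r s W]^fin}.
Local Notation poly := {mpoly R[n.+1]}.
Local Notation Y := (@Ypoly n r s W K).
Local Notation tau := (@target n r s W K).
Local Notation tau' := (@initial_target n r s W K).
Local Notation sig := (@sigma n r s W K).
Local Notation ke := (key_exp r s W).
Local Notation kc := (key_cofactor r s W).
Local Notation chi := (key_mono r s W).
Local Notation seeds := (target_seeds r s W).

Implicit Types (m u t v w b : monomial) (i j k : 'I_n.+1) (p : poly).

Definition nf : poly -> poly :=
  mono_lift (fun t => if t \in O then 'X_[t] else - (Y t + tau t)).

HB.instance Definition _ := GRing.Linear.on nf.

Lemma nfE p : nf p = subst_targets tau p.
Proof. by []. Qed.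

Lemma nfO t : t \in O -> nf 'X_[t] = 'X_[t].
Proof. by move=> tO; rewrite /nf mono_liftX tO. Qed.

Lemma nfN m : m \notin O -> nf 'X_[m] = - (Y m + tau m).
Proof. by move=> mO; rewrite /nf mono_liftX (negbTE mO). Qed.

Lemma Y_notin_LM m : m \notin LM r s W -> Y m = 0.
Proof. by move=> mLM; rewrite /Ypoly insubN. Qed.

Lemma Y_LM (b : seq_sub (LM r s W)) :
  Y (val b) = - \sum_(t : seq_sub (TM r s W)) Cvar K t b *: 'X_[val t].
Proof. by rewrite /Ypoly valK. Qed.

Lemma mem_TM t : (t \in TM r s W) = (mdeg t == s) && (t \in O).
Proof. by rewrite mem_filter. Qed.

Lemma Y_supp m u : u \notin TM r s W -> (Y m)@_u = 0.
Proof.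
move=> uTM; rewrite /Ypoly; case: insubP => [b _ _|_]; last exact: mcoeff0.
rewrite mcoeffN raddf_sum big1 ?oppr0 //= => t _; rewrite mcoeffZ mcoeffX.
by case: eqP uTM => [<-|]; rewrite ?mulr0 // (ssvalP t).
Qed.

Lemma Y_suppO m u : u \notin O -> (Y m)@_u = 0.
Proof. by move=> uO; rewrite Y_supp // mem_TM (negbTE uO) andbF. Qed.

Lemma subst_targets_supp (f : monomial -> poly) p u :
  (forall m, (f m)@_u = 0) -> u \notin O -> (subst_targets f p)@_u = 0.
Proof.
move=> f0 uO; rewrite /subst_targets raddf_sum big1 //= => m _.
rewrite mcoeffZ; case: ifP => mO; last first.
  by rewrite mcoeffN mcoeffD Y_suppO // f0 addr0 oppr0 mulr0.
by rewrite mcoeffX; case: eqP uO => [<-|]; rewrite ?mulr0 // mO.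
Qed.

Lemma targets_supp l m u : u \notin O -> (@targets n r s W K l m)@_u = 0.
Proof.
move=> uO; elim: l m => [|a l IH] m /=; first exact: mcoeff0.
by case: eqP => _ //; exact: subst_targets_supp.
Qed.

Lemma nf_supp p u : u \notin O -> (nf p)@_u = 0.
Proof.
by move=> uO; rewrite nfE; apply: subst_targets_supp => // m; exact: targets_supp.
Qed.

Lemma targets0 l m : m \notin l -> @targets n r s W K l m = 0.
Proof.
by elim: l => //= a l IH; rewrite inE negb_or => /andP[/negbTE-> /IH].
Qed.

Lemma eq_subst_targets (f g : monomial -> poly) p :
  {in msupp p, f =1 g} -> subst_targets f p = subst_targets g p.
Proof.
by move=> fg; apply: eq_big_seq => m mp; case: ifP => // _; rewrite fg.
Qed.

(** The recursion uses the table of the tail of the list. The whole table may replace it, because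
    the initial target only involves monomials strictly after [m], never [m] itself or an earlier
    entry. *)
Lemma targets_rec l m : sorted (@ndeglex_le n.+1) l -> m \in l ->
  (forall u, u \in msupp (tau' m) -> ndeglex_lt m u) ->
  @targets n r s W K l m = subst_targets (@targets n r s W K l) (tau' m).
Proof.
move=> + + later; elim: l => //= a l IH path_l; rewrite inE.
case: eqP => [<- _|nma /= ml].
  apply: eq_subst_targets => u /later; case: eqP => // ->.
  by rewrite ndeglex_ltxx.
rewrite (IH (path_sorted path_l) ml); apply: eq_subst_targets => u /later.
case: eqP => // ->; rewrite ndeglex_ltNge.
by rewrite (allP (order_path_min (@ndeglex_le_trans _) path_l) m ml).
Qed.

Lemma mem_Nset m : (m \in Nset r s W) = (m \notin O) && (mdeg m <= s.+1)%N.
Proof.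
rewrite mem_filter mem_monomials_le; apply: andb_id2r => _.
by apply: andb_idl; exact: notin_order_ideal_mdeg.
Qed.

Definition truncate : poly -> poly :=
  mono_lift (fun t => if (mdeg t <= s)%N then 'X_[t] else 0).

HB.instance Definition _ := GRing.Linear.on truncate.

Lemma truncateX t : truncate 'X_[t] = if (mdeg t <= s)%N then 'X_[t] else 0.
Proof. by rewrite /truncate mono_liftX. Qed.

Lemma mul_sigma p k :
  p * sig k = \sum_(q : seq_sub (seeds k)) theta K q *: (p * 'X_[val q]).
Proof. by rewrite mulr_sumr; apply: eq_bigr => q _; rewrite -scalerAr. Qed.

Lemma initial_targetE m k : m \notin O -> (mdeg m <= s)%N -> lv m == Some k ->
  tau' m = truncate ('X_[(m - U_(k) *+ ke k)%MM] * sig k).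
Proof.
move=> mO les /eqP lvm; rewrite /initial_target les lvm big_mkcond.
by apply: eq_bigr => t _; case: ifP; rewrite ?scaler0.
Qed.

Lemma initial_target_later m u : m \notin O -> u \in msupp (tau' m) -> ndeglex_lt m u.
Proof.
move=> mO; have [les|gts] := leqP (mdeg m) s; last first.
  by rewrite /initial_target leqNgt gts msupp0.
have /lv_exists[k lvm] : m != 0%MM.
  by apply: contraNneq mO => ->; exact: zero_in_order_ideal.
rewrite (initial_targetE mO les lvm) mul_sigma linear_sum mcoeff_msupp raddf_sum /=.
move=> nz; have [q] : exists q : seq_sub (seeds k),
    u == (m - U_(k) *+ ke k + val q)%MM.
  apply/existsP; apply: contraNT nz => /existsPn nu; rewrite big1 // => q _.
  rewrite linearZ /= mcoeffZ -mpolyXD truncateX; case: ifP => _; last first.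
    by rewrite mcoeff0 mulr0.
  by rewrite mcoeffX eq_sym (negbTE (nu q)) mulr0.
move=> /eqP ->; rewrite -{1}(key_divide adm mO les lvm).
by apply: target_seed_after => //; exact: ssvalP.
Qed.

Lemma target_rec m : m \notin O -> (mdeg m <= s.+1)%N -> tau m = nf (tau' m).
Proof.
move=> mO les; rewrite nfE; apply: targets_rec.
- by apply: sort_sorted; exact: ndeglex_le_total.
- by rewrite mem_sort mem_Nset mO.
- by move=> u; exact: initial_target_later.
Qed.

Lemma nf_high m : (s < mdeg m)%N -> nf 'X_[m] = 0.
Proof.
move=> gts; have mO : m \notin O.
  by apply: contraL gts => /(order_ideal_mdeg adm); rewrite -leqNgt.
rewrite nfN // Y_notin_LM ?add0r; last first.
  by apply: contraL gts => /(LM_mdeg adm); rewrite -leqNgt.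
(* Above degree [s + 1] the monomial is not listed in [Nset] and [targets] returns its default 0; in
   degree [s + 1] the initial target is 0. *)
have [les1|gts1] := leqP (mdeg m) s.+1; last first.
  by rewrite /tau targets0 ?oppr0 // mem_sort mem_Nset; lia.
by rewrite target_rec // /initial_target leqNgt gts linear0 oppr0.
Qed.

(** By [nf_high], the terms deleted from an initial target are invisible to [nf]. *)
Lemma nf_truncate p : nf (truncate p) = nf p.
Proof.
rewrite (mpolyE p) (linear_sum truncate) !(linear_sum nf) /=.
apply: eq_bigr => m _; rewrite (linearZZ truncate) !(linearZZ nf) /= truncateX.
by case: leqP => [_ //|gts]; rewrite (nf_high gts) (linear0 nf).
Qed.

Lemma nf_low m k : m \notin O -> (mdeg m <= s)%N -> lv m == Some k ->
  nf 'X_[m] = - (Y m + nf ('X_[(m - U_(k) *+ ke k)%MM] * sig k)).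
Proof.
move=> mO les lvm; rewrite (nfN mO) (target_rec mO (leqW les)).
by rewrite (initial_targetE mO les lvm) nf_truncate.
Qed.

Lemma nf_mul_sigma p k :
  nf (p * sig k) = \sum_(q : seq_sub (seeds k)) theta K q *: nf (p * 'X_[val q]).
Proof. exact: linear_mul_sumZ. Qed.

Lemma mcoeff_nf_mul_sigma p k u : (nf (p * sig k))@_u =
  \sum_(q : seq_sub (seeds k)) theta K q * (nf (p * 'X_[val q]))@_u.
Proof.
rewrite nf_mul_sigma (raddf_sum (mcoeff u)).
by apply: eq_bigr => q _; rewrite [LHS]mcoeffZ.
Qed.

Lemma nf_sigma0 p k : (forall q, q \in seeds k -> nf (p * 'X_[q]) = 0) ->
  nf (p * sig k) = 0.
Proof.
move=> p0; rewrite nf_mul_sigma big1 // => q _.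
by rewrite p0 ?scaler0 //; exact: ssvalP.
Qed.

(** * The kernel of [nf] is an ideal *)

Local Notation key_poly k := ('X_[U_(k) *+ ke k] + sig k).

Lemma nf_key_high w k : (s < mdeg w + ke k)%N -> nf ('X_[w] * key_poly k) = 0.
Proof.
move=> gts; rewrite mulrDr linearD /= -mpolyXD nf_high ?add0r; last first.
  by rewrite mdegD mdegMn mdeg1 mul1n.
apply: nf_sigma0 => q /(mdeg_target_seed adm) leq; rewrite -mpolyXD nf_high //.
by rewrite mdegD; lia.
Qed.

(** Outside [LM] the term [Y] vanishes, and [nf_low] then says exactly that the two summands
    cancel. *)
Lemma nf_key_not_LM w k : (w + U_(k) *+ ke k)%MM \notin O ->
  lv (w + U_(k) *+ ke k)%MM == Some k -> (w + U_(k) *+ ke k)%MM \notin LM r s W ->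
  nf ('X_[w] * key_poly k) = 0.
Proof.
set m := (w + _)%MM => mO lvm mLM; have [les|gts] := leqP (mdeg m) s; last first.
  by apply: nf_key_high; move: gts; rewrite mdegD mdegMn mdeg1 mul1n.
rewrite mulrDr linearD /= -mpolyXD -/m (nf_low mO les lvm) Y_notin_LM // add0r.
by rewrite /m addmK addNr.
Qed.

(* For a variable [x_j] larger than [x_k] dividing [v], the exponent of [chi_j]
   is 1, and [X_v * X_w * key_poly k] is rewritten with the help of
   [x_j + sigma_j] into products involving only later monomials [v]. *)
Lemma nf_key_mul m k v : m \notin O -> (mdeg m <= s)%N -> lv m == Some k ->
  v != 0%MM -> nf ('X_[v] * ('X_[(m - U_(k) *+ ke k)%MM] * key_poly k)) = 0.
Proof.
move=> mO les lvm; set w := (m - _)%MM.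
have wE : (w + U_(k) *+ ke k)%MM = m by exact: (key_divide adm mO les lvm).
have [mk m0] := elimT (lvP _ _) lvm.
elim/(@ndeglex_ind n.+1 s): v => v IH v0; rewrite mulrA -mpolyXD.
have vwE : (v + w + U_(k) *+ ke k)%MM = (v + m)%MM by rewrite -addmA wE.
have [j lvv] := lv_exists v0; have [vj vj0] := elimT (lvP _ _) lvv.
have [lekj|ltjk] := leqP k j.
  have vi : (v + m)%MM = (U_(j) + (v - U_(j) + m))%MM by rewrite addmA mnmU_subK.
  apply: nf_key_not_LM; rewrite vwE.
  - by apply: contra mO; apply: order_ideal_dvd => //; exact: lem_addl.
  - apply/lvP; rewrite mnmDE addn_gt0 mk orbT; split => // i ltik.
    by rewrite mnmDE m0 // vj0 // (leq_trans ltik).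
  - rewrite vi; apply: (notin_LMU adm); apply: contra mO; apply: order_ideal_dvd => //.
    exact: lem_addl.
have ej := key_exp_larger_var adm mO les lvm ltjk.
pose v' := (v - U_(j))%MM; have vE : v = (v' + U_(j))%MM by rewrite addmC mnmU_subK.
have degm : (0 < mdeg m)%N.
  by have := notin_order_ideal_mdeg adm mO; case: adm => -[]; lia.
(* Both [x_j u] and its quotient by any variable of [u] contain [x_j] in degree at least that of
   [m]. By [notin_larger_var] they are outside [O], so [x_j u] is not in [LM]. *)
have key_j u : (forall i, (i < j)%N -> u i = 0%N) -> (mdeg m <= mdeg u)%N ->
    nf ('X_[u] * key_poly j) = 0.
  move=> u0 leu; apply: nf_key_not_LM; rewrite ej mulm1n.
  - apply: (notin_larger_var adm mO lvm ltjk); first by rewrite mnmDE mnm1E eqxx addn1.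
    by rewrite mdegD; lia.
  - apply/lvP; rewrite mnmDE mnm1E eqxx addn1; split => // i ltij.
    by rewrite mnmDE mnm1E u0 // -val_eqE /= gtn_eqF.
  - have /lv_exists[i /lvP[ui _]] : u != 0%MM.
      by rewrite -mdeg_eq0; lia.
    rewrite -(mnmU_subK ui) -addmA; apply: (notin_LMU adm).
    apply: (notin_larger_var adm mO lvm ltjk).
      by rewrite mnmDE [in X in (_ + X)%N]mnm1E eqxx addn1.
    by move: leu; rewrite -{1}(mnmU_subK ui) !mdegD !mdeg1; lia.
have v'0 i : (i < j)%N -> v' i = 0%N by move=> ltij; rewrite mnmBE vj0.
have w0 i : (i < j)%N -> w i = 0%N.
  by move=> ltij; rewrite mnmBE m0 // (ltn_trans ltij).
rewrite mpolyXD -mulrA; set P := 'X_[w] * _; set y := key_poly j in key_j.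
(* Expanding the factor [key_poly k] of [P] leaves multiples of [key_poly j] by monomials without
   variables larger than [x_j], to which [key_j] applies. *)
have Py0 : nf ('X_[v'] * P * y) = 0.
  have expand (A : comNzRingType) (a c d e f : A) :
      a * (c * (d + e)) * f = a * c * d * f + a * c * f * e.
    by rewrite mulrA mulrDr mulrDl [a * c * e * f]mulrAC.
  rewrite /P expand linearD /= -!mpolyXD.
  rewrite key_j ?add0r.
  - apply: nf_sigma0 => q qk; rewrite mulrAC -mpolyXD key_j // => [i ltij|].
      by rewrite !mnmDE v'0 ?w0 // (target_seed_small adm qk) // (ltn_trans ltij).
    rewrite -wE !mdegD mdegMn mdeg1 mul1n.
    by have := mdeg_target_seed adm qk; lia.
  - by move=> i ltij; rewrite -addmA wE mnmDE v'0 // m0 // (ltn_trans ltij).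
  - by rewrite -addmA wE mdegD leq_addl.
(* As [e_j = 1], each [v' q] comes after [v' x_j = v]: the induction hypothesis applies unless the
   degree exceeds [s]. *)
have Psig0 : nf ('X_[v'] * P * sig j) = 0.
  apply: nf_sigma0 => q qj; rewrite mulrAC -mpolyXD.
  have degq := mdeg_target_seed adm qj; rewrite ej in degq.
  have [les'|gts'] := leqP (mdeg (v' + q)%MM) s; last first.
    rewrite /P mulrA -mpolyXD nf_key_high //.
    by rewrite [mdeg (_ + w)]mdegD (leq_trans gts') // -addnA leq_addr.
  apply: IH => //; last by rewrite -mdeg_eq0 mdegD; lia.
  by rewrite vE; have := target_seed_after adm v' qj; rewrite ej mulm1n.
by move: Py0; rewrite /y mulrDr linearD /= Psig0 addr0 ej mulm1n mulrAC -mpolyXD -vE.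
Qed.

(** By [nf_key_mul] with [v = x_i], [x_i m] may be replaced by minus [x_i] times [w * sigma_k],
    whose monomials come after [m] and fall under the induction. *)
Lemma nfX i m : nf ('X_i * 'X_[m]) = nf ('X_i * nf 'X_[m]).
Proof.
have nfi_high u : (s <= mdeg u)%N -> nf ('X_i * 'X_[u]) = 0.
  by move=> leu; rewrite -mpolyXD nf_high // mdegD mdeg1.
elim/(@ndeglex_ind n.+1 s): m => m IH.
have [mO|mO] := boolP (m \in O); first by rewrite (nfO mO).
have [les|gts] := leqP (mdeg m) s; last first.
  by rewrite (nf_high gts) mulr0 (linear0 nf) nfi_high // ltnW.
have /lv_exists[k lvm] : m != 0%MM.
  by apply: contraNneq mO => ->; exact: zero_in_order_ideal.
have wE := key_divide adm mO les lvm.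
have key0 := nf_key_mul (v := U_(i)%MM) mO les lvm.
rewrite (nf_low mO les lvm); move: wE key0; set w := (m - _)%MM => wE.
rewrite mnm1_eq0 => /(_ isT).
rewrite mulrDr -mpolyXD wE mulrDr (linearD nf) => /eqP; rewrite addr_eq0 => /eqP ->.
rewrite mulrN (linearN nf) mulrDr (linearD nf) /=; congr (- _).
(* The monomials of [TM] have degree [s], so multiplying by [x_i] passes the bound of [nf_high]. *)
have -> : nf ('X_i * Y m) = 0.
  rewrite (mpolyE (Y m)) mulr_sumr (linear_sum nf) big_seq big1 //= => u uY.
  rewrite -scalerAr (linearZZ nf) /= nfi_high ?scaler0 //.
  suff : u \in TM r s W by rewrite mem_TM => /andP[/eqP->].
  by apply: contraLR uY => /(Y_supp m) /eqP; rewrite mcoeff_eq0.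
have IHq (q : seq_sub (seeds k)) :
    nf ('X_i * ('X_[w] * 'X_[val q])) = nf ('X_i * nf ('X_[w] * 'X_[val q])).
  rewrite -[in LHS]mpolyXD -[in RHS]mpolyXD.
  have [les'|gts'] := leqP (mdeg (w + val q)%MM) s; last first.
    by rewrite (nf_high gts') mulr0 (linear0 nf) (nfi_high _ (ltnW gts')).
  apply: (IH _ les'); rewrite -wE; exact: (target_seed_after adm w (ssvalP q)).
rewrite add0r mulrA !nf_mul_sigma.
apply: etrans (esym (linear_mul_sumZ nf (@theta _ _ _ _ K k)
                       (fun q => nf ('X_[w] * 'X_[val q])) 'X_i)).
apply: eq_bigr => q _; rewrite -mulrA.
exact: (congr1 (GRing.scale (theta K q)) (IHq q)).
Qed.

Lemma MG_nf (b : seq_sub (border O)) : MG K b = 'X_[val b] - nf 'X_[val b].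
Proof.
have bO : val b \notin O by have := ssvalP b; rewrite mem_undup mem_filter => /andP[].
by rewrite (nfN bO) opprK addrA.
Qed.

Lemma MG_border_basis : is_border_basis (@MG n r s W K).
Proof.
exact: (nf_border_basis (zero_in_order_ideal adm) nfO nf_supp nfX MG_nf).
Qed.

(** * Surjectivity of the comorphism *)

Section Surjectivity.

Variable xi : {lrmorphism scheme_ring O K -> R}.
Hypothesis xi_MG : induced_comorphism (@MG n r s W K) xi.

Local Notation im x := (exists a, xi a = x).

Lemma im_nat (c : nat) : im c%:R.
Proof. by exists c%:R; rewrite rmorph_nat. Qed.

Lemma im_sub x y : im x -> im y -> im (x - y).
Proof. by move=> [a <-] [b <-]; exists (a - b); rewrite rmorphB. Qed.

Lemma im_opp x : im x -> im (- x).
Proof. by move=> [a <-]; exists (- a); rewrite rmorphN. Qed.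

Lemma im_sum_mul (I : Type) (l : seq I) (f g : I -> R) :
  (forall x, im (f x)) -> (forall x, im (g x)) -> im (\sum_(x <- l) f x * g x).
Proof.
move=> imf img; elim/big_rec: _ => [|x y _ [a <-]]; first exact: (im_nat 0).
have [b <-] := imf x; have [c <-] := img x.
by exists (b * c + a); rewrite rmorphD rmorphM.
Qed.

Lemma im_nf_border b t : b \in border O -> t \in O -> im ((nf 'X_[b])@_t).
Proof.
move=> bB tO; exists (scheme_proj (cvar K (SeqSub tO) (SeqSub bB))).
rewrite xi_MG MG_nf mcoeffB mcoeffX /= opprB.
case: eqP => [bt|_]; last by rewrite subr0.
by move: bB; rewrite bt mem_undup mem_filter tO.
Qed.

(** The product [t] of [q] and the cofactor lies in [O], so [nf] fixes it; its degree is below [s],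
    out of reach of [Y]; other seeds give other monomials. Hence the coefficient of [nf 'X_[chi k]]
    at [t] isolates [theta]. *)
Lemma im_theta k (q : seq_sub (seeds k)) : im (theta K q).
Proof.
have [keyk [t [tO /andP[_ ltts] tE]]] := target_seedsP adm (ssvalP q).
have [chiLM lvchi _] := key_monoP adm keyk.
suff e : (nf 'X_[chi k])@_t = - theta K q.
  rewrite -[theta K q]opprK -e; apply: im_opp; apply: im_nf_border => //.
  exact: LM_border.
rewrite (nf_low (LM_notin adm chiLM) (LM_mdeg adm chiLM) lvchi) mcoeffN mcoeffD.
rewrite Y_supp ?add0r; last by rewrite mem_TM ltn_eqF.
rewrite -[(chi k - _)%MM]/(kc k) mcoeff_nf_mul_sigma (bigD1 q) //=.
rewrite -mpolyXD addmC tE (nfO tO) mcoeffX eqxx mulr1 big1 ?addr0 // => q' nq.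
have [_ [t' [t'O _ t'E]]] := target_seedsP adm (ssvalP q').
rewrite -mpolyXD addmC t'E (nfO t'O) mcoeffX -t'E -tE eqm_add2r.
by rewrite (inj_eq val_inj) (negbTE nq) mulr0.
Qed.

Lemma im_nf_mul_sigma m k u : m \notin O -> (mdeg m <= s)%N -> lv m == Some k ->
  (forall m', m' \notin O -> (mdeg m' <= s)%N -> ndeglex_lt m m' ->
     im ((nf 'X_[m'])@_u)) ->
  im ((nf ('X_[(m - U_(k) *+ ke k)%MM] * sig k))@_u).
Proof.
move=> mO les lvm IH; rewrite mcoeff_nf_mul_sigma.
apply: im_sum_mul => q; first exact: im_theta.
rewrite -mpolyXD; set m' := (_ + val q)%MM.
have [m'O|m'O] := boolP (m' \in O); first by rewrite (nfO m'O) mcoeffX; exact: im_nat.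
have [les'|gts] := leqP (mdeg m') s; last first.
  by rewrite (nf_high gts) mcoeff0; exact: (im_nat 0).
apply: IH => //; rewrite -{1}(key_divide adm mO les lvm).
by apply: target_seed_after => //; exact: ssvalP.
Qed.

(** Needed because monomials outside [O] that arise from [sigma_k] may be off the border. Elements
    of [LM] are on the border; for the others [Y] vanishes, and [nf] is expressed by later
    monomials. *)
Lemma im_nf m u : m \notin O -> im ((nf 'X_[m])@_u).
Proof.
elim/(@ndeglex_ind n.+1 s): m => m IH mO.
have [uO|uO] := boolP (u \in O); last by rewrite nf_supp //; exact: (im_nat 0).
have [mLM|mLM] := boolP (m \in LM r s W).
  by apply: im_nf_border => //; exact: LM_border.
have [les|gts] := leqP (mdeg m) s; last first.
  by rewrite (nf_high gts) mcoeff0; exact: (im_nat 0).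
have /lv_exists[k lvm] : m != 0%MM.
  by apply: contraNneq mO => ->; exact: zero_in_order_ideal.
rewrite (nf_low mO les lvm) (Y_notin_LM mLM) add0r mcoeffN; apply: im_opp.
by apply: im_nf_mul_sigma => // m' m'O les' lt'; exact: IH.
Qed.

Lemma im_Cvar (t : seq_sub (TM r s W)) (b : seq_sub (LM r s W)) : im (Cvar K t b).
Proof.
have bLM := ssvalP b; have bO := LM_notin adm bLM; have les := LM_mdeg adm bLM.
have /lv_exists[k lvb] : val b != 0%MM.
  by apply: contraNneq bO => ->; exact: zero_in_order_ideal.
have tE : (Y (val b))@_(val t) = - Cvar K t b.
  rewrite Y_LM mcoeffN raddf_sum (bigD1 t) //= mcoeffZ mcoeffX eqxx mulr1 big1 ?addr0 //.
  by move=> t' nt; rewrite mcoeffZ mcoeffX (inj_eq val_inj) (negbTE nt) mulr0.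
set w := (val b - U_(k) *+ ke k)%MM.
(* [nf_low] read at the coefficient of [t] and solved for the indeterminate. *)
have -> : Cvar K t b
    = (nf 'X_[val b])@_(val t) - - (nf ('X_[w] * sig k))@_(val t).
  by rewrite (nf_low bO les lvb) mcoeffN mcoeffD tE opprK opprD opprK subrK.
apply: im_sub; first exact: im_nf.
by apply/im_opp/im_nf_mul_sigma => // m' m'O _ _; exact: im_nf.
Qed.

Lemma comorphism_surj y : im y.
Proof.
by apply: mpoly_fin_surj y => -[[t b]|[k q]]; [exact: im_Cvar|exact: im_theta].
Qed.

End Surjectivity.

Lemma MG_comorphism : exists xi : {lrmorphism scheme_ring O K -> R},
  induced_comorphism (@MG n r s W K) xi.
Proof.
exact: (nf_comorphism (zero_in_order_ideal adm) nfO nf_supp nfX MG_nf).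
Qed.

End Targets.

Theorem proposition3 (K : closedFieldType) (charK : [pchar K] =i pred0)
    (n r s : nat) (W : nat -> 'X_{1..n.+1}) (adm : admissible r s W) :
  is_border_basis (@MG n r s W K) /\
  exists xi : {lrmorphism scheme_ring (order_ideal r s W) K ->
                 {mpoly K[param r s W]^fin}},
    induced_comorphism (@MG n r s W K) xi /\
    (forall y, exists x, xi x = y).
Proof.
split; first exact: MG_border_basis.
have [xi xiE] := MG_comorphism adm K.
by exists xi; split=> //; exact: (comorphism_surj adm xiE).
Qed.
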